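(* The Kodaira-Thurston surface $(M,J)$ described in the context admits $T^2$-invariant Vaisman metrics with non-constant scalar curvature.
   Context: The Kodaira-Thurston surface is the compact $4$-manifold $M=\mathrm{Nil}^3/\Gamma\times S^1$, where $\mathrm{Nil}^3$ is the real Heisenberg group of matrices $\begin{pmatrix}1&x&z\\0&1&y\\0&0&1\end{pmatrix}$, $x,y,z\in\mathbb R$, and $\Gamma$ is the lattice of such matrices with integer entries; $w$ denotes the coordinate on the $S^1=\mathbb R/\mathbb Z$ factor. Smooth functions on $M$ are the smooth functions $f$ on $\mathbb R^4$ with $f(x+j,y+k,z+jy+m,w+n)=f(x,y,z,w)$ for all $(j,k,m,n)\in\mathbb Z^4$. A global coframe on $M$ is $$e^1=dy,\quad e^2=dx,\quad e^3=dw,\quad e^4=dz-x\,dy,$$ with $de^1=de^2=de^3=0$, $de^4=e^1\wedge e^2$, and dual frame $e_1=\partial_y+x\partial_z$, $e_2=\partial_x$, $e_3=\partial_w$, $e_4=\partial_z$. The complex structure $J$ is the one for which $\varphi^1=e^1+ie^2$ and $\varphi^2=e^3+ie^4$ form a global frame of $(1,0)$-forms, so on vectors $Je_1=e_2$, $Je_3=e_4$. $M$ is a principal $T^2$-bundle over the torus $T^2_{xy}$, with fibre coordinates $z,w$. A Hermitian metric $g$ on $(M,J)$ with fundamental form $\omega$, where $g(X,Y)=\omega(X,JY)$, is $T^2$-invariant if the coefficients of $\omega$ in the coframe $e^1,\dots,e^4$ depend only on $(x,y)$. In complex dimension $2$ the Lee form $\theta$ of a Hermitian metric $g$ is the unique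 $1$-form with $d\omega=\theta\wedge\omega$; the metric is Vaisman if $d\theta=0$ and $\nabla^{LC}\theta=0$, where $\nabla^{LC}$ is the Levi-Civita connection of $g$. The scalar curvature is that of the Riemannian metric $g$. *)

(* Defs.v *)
From mathcomp Require Import all_boot all_order all_algebra.
From mathcomp Require Import all_classical all_reals all_analysis.
From mathcomp Require Import ring.

Set Implicit Arguments.
Unset Strict Implicit.
Unset Printing Implicit Defensive.

Import Order.TTheory GRing.Theory Num.Theory.
Import numFieldNormedType.Exports.

Local Open Scope ring_scope.

(* Points of R^4, with coordinates (x, y, z, w). *)
Definition R4 (R : realType) := 'rV[R]_4.

(* The i-th coordinate function (i = 0, 1, 2, 3 for x, y, z, w). *)
Definition crd (R : realType) (i : nat) (p : R4 R) : R := p 0 (inord i).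

Definition mkrow (R : realType) (s : seq R) : 'rV[R]_4 := \row_(j < 4) s`_j.

(** Smooth functions on M *)

Definition partial (R : realType) (i : 'I_4) (f : R4 R -> R) : R4 R -> R :=
  fun p => 'D_(delta_mx 0 i) f p.

Definition partials (R : realType) (s : seq 'I_4) (f : R4 R -> R) :
  R4 R -> R := foldr (@partial R) f s.

Definition smooth (R : realType) (f : R4 R -> R) : Prop :=
  forall s : seq 'I_4, continuous (partials s f) /\
    forall (i : 'I_4) (p : R4 R), derivable (partials s f) p (delta_mx 0 i).

Definition lattice_act (R : realType) (j k m n : int) (p : R4 R) : R4 R :=
  mkrow [:: crd 0 p + j%:~R; crd 1 p + k%:~R;
            crd 2 p + j%:~R * crd 1 p + m%:~R; crd 3 p + n%:~R].

Definition smooth_on_M (R : realType) (f : R4 R -> R) : Prop :=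
  smooth f /\
  forall (j k m n : int) (p : R4 R), f (lattice_act j k m n p) = f p.

(** The invariant frame.  All tensors on M are given by their components in the
    frame e_1, ..., e_4 (indexed by 0, ..., 3), so that a smooth tensor on M is
    one whose components are smooth functions on M.  A vector X = \sum_a X_a e_a
    and a 1-form \sum_a t_a e^a are both written as row vectors. *)

(* e_(a+1) at p, in the coordinate basis d/dx, d/dy, d/dz, d/dw:
   e_1 = d/dy + x d/dz, e_2 = d/dx, e_3 = d/dw, e_4 = d/dz. *)
Definition frame (R : realType) (a : 'I_4) (p : R4 R) : 'rV[R]_4 :=
  nth 0 [:: mkrow [:: 0; 1; crd 0 p; 0];
            mkrow [:: 1; 0; 0; 0];
            mkrow [:: 0; 0; 0; 1];
            mkrow [:: 0; 0; 1; 0]] a.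

(* e^(a+1) at p, in the basis dx, dy, dz, dw:
   e^1 = dy, e^2 = dx, e^3 = dw, e^4 = dz - x dy. *)
Definition coframe (R : realType) (a : 'I_4) (p : R4 R) : 'rV[R]_4 :=
  nth 0 [:: mkrow [:: 0; 1; 0; 0];
            mkrow [:: 1; 0; 0; 0];
            mkrow [:: 0; 0; 0; 1];
            mkrow [:: 0; - crd 0 p; 1; 0]] a.

(* e_(a+1) acting on functions *)
Definition fd (R : realType) (a : 'I_4) (f : R4 R -> R) (p : R4 R) : R :=
  'D_(frame a p) f p.

(* Lie bracket of vector fields on R^4, in coordinates *)
Definition lie_bracket (R : realType) (X Y : R4 R -> 'rV[R]_4) (p : R4 R) :
  'rV[R]_4 := 'D_(X p) Y p - 'D_(Y p) X p.

(* Frame components of [e_(a+1), e_(b+1)]: the only nonzero brackets are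
   [e_1, e_2] = - e_4 = - [e_2, e_1]; see frame_bracket. *)
Definition bracket (R : realType) (a b : 'I_4) : 'rV[R]_4 :=
  if (a == 0 :> nat) && (b == 1 :> nat) then mkrow [:: 0; 0; 0; -1]
  else if (a == 1 :> nat) && (b == 0 :> nat) then mkrow [:: 0; 0; 0; 1]
  else 0.

(* The complex structure: J e_1 = e_2, J e_2 = - e_1, J e_3 = e_4,
   J e_4 = - e_3; row a holds the components of J e_(a+1), so J X = X *m Jmx. *)
Definition Jmx (R : realType) : 'M[R]_4 :=
  \matrix_(a < 4) mkrow (nth [::] [:: [:: 0; 1; 0; 0];
                                      [:: -1; 0; 0; 0];
                                      [:: 0; 0; 0; 1];
                                      [:: 0; 0; -1; 0]] a).

(** Forms *)

(* The value of the bilinear form with matrix B *)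
Definition bil (R : realType) (B : 'M[R]_4) (X Y : 'rV[R]_4) : R :=
  (X *m B *m Y^T) 0 0.

Definition form1_on_M (R : realType) (theta : R4 R -> 'rV[R]_4) : Prop :=
  forall a : 'I_4, smooth_on_M (fun p => theta p 0 a).

(* d theta (e_a, e_b) = e_a theta(e_b) - e_b theta(e_a) - theta([e_a, e_b]) *)
Definition d1 (R : realType) (theta : R4 R -> 'rV[R]_4) (a b : 'I_4)
    (p : R4 R) : R :=
  fd a (fun q => theta q 0 b) p - fd b (fun q => theta q 0 a) p
  - \sum_(k < 4) bracket R a b 0 k * theta p 0 k.

(* The same invariant formula for the exterior derivative of the 2-form with
   matrix omega(e_a, e_b). *)
Definition d2 (R : realType) (omega : R4 R -> 'M[R]_4) (a b c : 'I_4)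
    (p : R4 R) : R :=
  fd a (fun q => omega q b c) p - fd b (fun q => omega q a c) p
  + fd c (fun q => omega q a b) p
  - \sum_(k < 4) bracket R a b 0 k * omega p k c
  + \sum_(k < 4) bracket R a c 0 k * omega p k b
  - \sum_(k < 4) bracket R b c 0 k * omega p k a.

(* (theta /\ omega)(e_a, e_b, e_c) *)
Definition wedge12 (R : realType) (theta : R4 R -> 'rV[R]_4)
    (omega : R4 R -> 'M[R]_4) (a b c : 'I_4) (p : R4 R) : R :=
  theta p 0 a * omega p b c - theta p 0 b * omega p a c
  + theta p 0 c * omega p a b.

(** Hermitian metrics on (M, J) *)

Definition hermitian_metric (R : realType) (g : R4 R -> 'M[R]_4) : Prop :=
  [/\ forall a b : 'I_4, smooth_on_M (fun p => g p a b),
      forall (p : R4 R) (X Y : 'rV[R]_4), bil (g p) X Y = bil (g p) Y X,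
      forall (p : R4 R) (X : 'rV[R]_4), X != 0 -> 0 < bil (g p) X X
    & forall (p : R4 R) (X Y : 'rV[R]_4),
        bil (g p) (X *m Jmx R) (Y *m Jmx R) = bil (g p) X Y].

(* The form omega with g(X, Y) = omega(X, J Y); see fundamental_formP. *)
Definition fundamental_form (R : realType) (g : R4 R -> 'M[R]_4)
    (p : R4 R) : 'M[R]_4 := g p *m Jmx R.

Definition T2_invariant (R : realType) (omega : R4 R -> 'M[R]_4) : Prop :=
  forall p q : R4 R,
    crd 0 p = crd 0 q -> crd 1 p = crd 1 q -> omega p = omega q.

(** Levi-Civita connection and curvature *)

(* C a b p is the vector (nabla_(e_a) e_b)(p). *)
Definition connection (R : realType) := 'I_4 -> 'I_4 -> R4 R -> 'rV[R]_4.

Definition is_levi_civita (R : realType) (g : R4 R -> 'M[R]_4)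
    (C : connection R) : Prop :=
  (forall (a b : 'I_4) (p : R4 R), C a b p - C b a p = bracket R a b) /\
  (forall (a b c : 'I_4) (p : R4 R),
     fd a (fun q => g q b c) p
     = bil (g p) (C a b p) (delta_mx 0 c) + bil (g p) (delta_mx 0 b) (C a c p)).

(* Koszul formula for g(nabla_(e_a) e_b, e_d) *)
Definition koszul (R : realType) (g : R4 R -> 'M[R]_4) (a b d : 'I_4)
    (p : R4 R) : R :=
  2^-1 * (fd a (fun q => g q b d) p + fd b (fun q => g q a d) p
          - fd d (fun q => g q a b) p
          + bil (g p) (bracket R a b) (delta_mx 0 d)
          - bil (g p) (bracket R a d) (delta_mx 0 b)
          - bil (g p) (bracket R b d) (delta_mx 0 a)).

(* The unique torsion-free metric connection; see levi_civitaP. *)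
Definition levi_civita (R : realType) (g : R4 R -> 'M[R]_4) : connection R :=
  fun a b p => (\row_d koszul g a b d p) *m invmx (g p).

(* nabla_(e_a) V *)
Definition nabla (R : realType) (C : connection R) (a : 'I_4)
    (V : R4 R -> 'rV[R]_4) (p : R4 R) : 'rV[R]_4 :=
  (\row_d fd a (fun q => V q 0 d) p) + \sum_(b < 4) V p 0 b *: C a b p.

(* (nabla_(e_a) theta)(e_b) = e_a theta(e_b) - theta(nabla_(e_a) e_b) *)
Definition nabla_form (R : realType) (C : connection R)
    (theta : R4 R -> 'rV[R]_4) (a b : 'I_4) (p : R4 R) : R :=
  fd a (fun q => theta q 0 b) p - \sum_(k < 4) C a b p 0 k * theta p 0 k.

(* R(e_a, e_b) e_c
   = nabla_a nabla_b e_c - nabla_b nabla_a e_c - nabla_[e_a, e_b] e_c *)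
Definition curvature (R : realType) (C : connection R) (a b c : 'I_4)
    (p : R4 R) : 'rV[R]_4 :=
  nabla C a (C b c) p - nabla C b (C a c) p
  - \sum_(k < 4) bracket R a b 0 k *: C k c p.

(* Ric(e_b, e_c), the trace of X |-> R(X, e_b) e_c *)
Definition ricci (R : realType) (C : connection R) (b c : 'I_4) (p : R4 R) : R :=
  \sum_(a < 4) curvature C a b c p 0 a.

Definition scalar_curvature (R : realType) (g : R4 R -> 'M[R]_4)
    (p : R4 R) : R :=
  \sum_(b < 4) \sum_(c < 4) invmx (g p) b c * ricci (levi_civita g) b c p.

(** Vaisman metrics *)

Definition lee_form (R : realType) (g : R4 R -> 'M[R]_4)
    (theta : R4 R -> 'rV[R]_4) : Prop :=
  form1_on_M theta /\
  forall (a b c : 'I_4) (p : R4 R),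
    d2 (fundamental_form g) a b c p = wedge12 theta (fundamental_form g) a b c p.

Definition vaisman (R : realType) (g : R4 R -> 'M[R]_4) : Prop :=
  exists theta : R4 R -> 'rV[R]_4,
    [/\ lee_form g theta,
        forall (a b : 'I_4) (p : R4 R), d1 theta a b p = 0
      & forall (a b : 'I_4) (p : R4 R),
          nabla_form (levi_civita g) theta a b p = 0].

(** The definitions above mean what they should *)

Lemma frame_coframe (R : realType) (a b : 'I_4) (p : R4 R) :
  (coframe a p *m (frame b p)^T) 0 0 = (a == b)%:R.
Proof.
rewrite mxE !big_ord_recl big_ord0 !mxE.
by case: a => [[|[|[|[|//]]]] ?]; case: b => [[|[|[|[|//]]]] ?];
  rewrite /coframe /frame /= !mxE /= -?val_eqE /=; ring.
Qed.

Lemma frame_bracket (R : realType) (a b : 'I_4) (p : R4 R) :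
  lie_bracket (frame a) (frame b) p
  = \sum_(k < 4) bracket R a b 0 k *: frame k p.
Proof.
have Dcst (c v : 'rV[R]_4) : 'D_v (fun _ : R4 R => c) p = 0.
  exact: derive_cst.
pose F0 (q : R4 R) : 'rV[R]_4 := mkrow [:: 0; 1; crd 0 q; 0].
have D0 (v : 'rV[R]_4) : 'D_v F0 p = crd 0 v *: mkrow [:: 0; 0; 1; 0].
  rewrite /derive; apply: cvg_lim => //.
  apply: (@cvg_trans _ ((fun=> crd 0 v *: mkrow [:: 0; 0; 1; 0]) @ (0 : R)^')%classic);
    last exact: cvg_cst.
  apply: near_eq_cvg; near=> h.
  have h0 : h != 0 by near: h; exact: nbhs_dnbhs_neq.
  apply/rowP => j; rewrite !mxE.
  by case: j => [[|[|[|[|//]]]] ?]; rewrite /= /crd ?mxE; field.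
have E0 (i : 'I_4) : (i = 0 :> nat) -> @frame R i = F0.
  by move=> i0; apply/funext => q; rewrite /frame i0.
rewrite !big_ord_recl big_ord0 /lie_bracket.
have [a0|a0] := eqVneq (a : nat) 0; have [b0|b0] := eqVneq (b : nat) 0.
- rewrite (E0 a) // (E0 b) // subrr /bracket a0 b0 /= !mxE; apply/rowP => j; rewrite !mxE; ring.
- have [c Hc] : exists c, @frame R b = (fun=> c).
    by exists (frame b 0); case: b b0 => [[|[|[|[|//]]]] ?] // _; apply/funext => q.
  rewrite (E0 a) // Hc Dcst D0 sub0r -[X in crd 0 X]/((fun=> c) p) -Hc.
  rewrite /bracket a0 /=; apply/rowP => j.
  case: b b0 {Hc} => [[|[|[|[|//]]]] ?] // _;
    rewrite /frame /crd /= !mxE ?inordK //=;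
    case: j => [[|[|[|[|//]]]] ?] /=; rewrite ?mxE /= ?inordK //=; ring.
- have [c Hc] : exists c, @frame R a = (fun=> c).
    by exists (frame a 0); case: a a0 => [[|[|[|[|//]]]] ?] // _; apply/funext => q.
  rewrite (E0 b) // Hc Dcst D0 subr0 -[X in crd 0 X]/((fun=> c) p) -Hc.
  rewrite /bracket b0 /= andbF /=; apply/rowP => j.
  case: a a0 {Hc} => [[|[|[|[|//]]]] ?] // _;
    rewrite /frame /crd /= !mxE ?inordK //=;
    case: j => [[|[|[|[|//]]]] ?] /=; rewrite ?mxE /= ?inordK //=; ring.
- have [c Hc] : exists c, @frame R a = (fun=> c).
    by exists (frame a 0); case: a a0 => [[|[|[|[|//]]]] ?] // _; apply/funext => q.
  have [d Hd] : exists d, @frame R b = (fun=> d).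
    by exists (frame b 0); case: b b0 => [[|[|[|[|//]]]] ?] // _; apply/funext => q.
  rewrite Hc Hd !Dcst subrr /bracket (negbTE a0) (negbTE b0) andbF /=.
  by apply/rowP => j; rewrite !mxE; ring.
Unshelve. all: by end_near. Qed.

Lemma Jmx_sqr (R : realType) : Jmx R *m Jmx R = - 1%:M.
Proof.
apply/matrixP => i j; rewrite !mxE !big_ord_recl big_ord0 !mxE -val_eqE.
by case: i => [[|[|[|[|//]]]] ?]; case: j => [[|[|[|[|//]]]] ?];
  rewrite /= ?mxE /=; ring.
Qed.

Lemma Jmx_tr (R : realType) : (Jmx R)^T = - Jmx R.
Proof.
apply/matrixP => i j; rewrite !mxE.
by case: i => [[|[|[|[|//]]]] ?]; case: j => [[|[|[|[|//]]]] ?];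
  rewrite /= ?mxE /=; ring.
Qed.

Lemma bil_delta (R : realType) (B : 'M[R]_4) (a b : 'I_4) :
  bil B (delta_mx 0 a) (delta_mx 0 b) = B a b.
Proof. by rewrite /bil trmx_delta -rowE -colE !mxE. Qed.

Lemma bil_deltar (R : realType) (B : 'M[R]_4) (X : 'rV[R]_4) (b : 'I_4) :
  bil B X (delta_mx 0 b) = (X *m B) 0 b.
Proof. by rewrite /bil trmx_delta -colE mxE. Qed.

Lemma fundamental_formP (R : realType) (g omega : R4 R -> 'M[R]_4) :
  (forall (p : R4 R) (X Y : 'rV[R]_4),
     bil (g p) X Y = bil (omega p) X (Y *m Jmx R))
  <-> (forall p : R4 R, omega p = fundamental_form g p).
Proof.
split=> [H p|H p X Y].
- rewrite /fundamental_form; have -> : g p = omega p *m (Jmx R)^T.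
    apply/matrixP => a b; rewrite -bil_delta H /bil trmx_mul mulmxA.
    by rewrite -(mulmxA _ (omega p)) -[LHS]/(bil _ _ _) bil_delta.
  by rewrite Jmx_tr mulmxN mulNmx -mulmxA Jmx_sqr mulmxN mulmx1 opprK.
- rewrite H /bil /fundamental_form trmx_mul Jmx_tr !mulmxA mulmxN !mulNmx.
  by rewrite -(mulmxA (X *m g p)) Jmx_sqr mulmxN mulmx1 mulNmx opprK.
Qed.

Lemma metric_unit (R : realType) (g : R4 R -> 'M[R]_4) (p : R4 R) :
  hermitian_metric g -> g p \in unitmx.
Proof.
case=> _ _ gpos _; rewrite -row_free_unit -kermx_eq0.
apply/negPn/negP => /rowV0Pn [v /sub_kermxP vg v0].
by have := gpos p v v0; rewrite /bil vg mul0mx mxE ltxx.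
Qed.

Lemma metric_sym (R : realType) (g : R4 R -> 'M[R]_4) (p : R4 R)
    (a b : 'I_4) : hermitian_metric g -> g p a b = g p b a.
Proof. by case=> _ gsym _ _; rewrite -!bil_delta gsym. Qed.

Lemma bracketC (R : realType) (a b : 'I_4) : bracket R b a = - bracket R a b.
Proof.
apply/rowP => j.
by case: a => [[|[|[|[|//]]]] ?]; case: b => [[|[|[|[|//]]]] ?];
  rewrite /bracket /= !mxE ?oppr0 //;
  case: j => [[|[|[|[|//]]]] ?] /=; ring.
Qed.

Lemma levi_civitaP (R : realType) (g : R4 R -> 'M[R]_4) (C : connection R) :
  hermitian_metric g ->
  is_levi_civita g C
  <-> (forall (a b : 'I_4) (p : R4 R), C a b p = levi_civita g a b p).
Proof.
move=> hg; have [_ gsym _ _] := hg.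
have gC a b : (fun q => g q a b) = (fun q => g q b a).
  by apply/funext => q; rewrite (metric_sym _ _ _ hg).
have bilB p X Y Z : bil (g p) (X - Y) Z = bil (g p) X Z - bil (g p) Y Z.
  by rewrite /bil !mulmxBl !mxE.
split=> [[tor met] a b p|H].
- have u := metric_unit p hg.
  rewrite /levi_civita -[LHS](mulmxK u); congr (_ *m _).
  apply/rowP => d; rewrite [RHS]mxE -bil_deltar /koszul !met -!(tor _ _ p) !bilB.
  rewrite !(gsym p (delta_mx 0 _)).
  by field.
have lc a b c p : bil (g p) (C a b p) (delta_mx 0 c) = koszul g a b c p.
  by rewrite bil_deltar H /levi_civita mulmxKV ?metric_unit // mxE.
split=> [a b p|a b c p].
- apply: (can_inj (mulmxK (metric_unit p hg))).
  apply/rowP => d; rewrite -!bil_deltar bilB !lc /koszul.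
  rewrite (bracketC _ a b) (gC b a).
  have -> : bil (g p) (- bracket R a b) (delta_mx 0 d)
            = - bil (g p) (bracket R a b) (delta_mx 0 d).
    by rewrite /bil !mulNmx mxE.
  by field.
- rewrite (gsym p (delta_mx 0 b)) !lc /koszul.
  rewrite (bracketC _ b c) (gC c b).
  have -> : bil (g p) (- bracket R b c) (delta_mx 0 a)
            = - bil (g p) (bracket R b c) (delta_mx 0 a).
    by rewrite /bil !mulNmx mxE.
  by field.
Qed.

(* Main.v *)
Require Import Defs.
From mathcomp Require Import all_boot all_order all_algebra.
From mathcomp Require Import all_classical all_reals all_analysis.
From mathcomp Require Import ring lra.

Set Implicit Arguments.
Unset Strict Implicit.
Unset Printing Implicit Defensive.

Import Order.TTheory GRing.Theory Num.Theory.
Import numFieldNormedType.Exports.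

Local Open Scope ring_scope.

(** On a complex surface a Vaisman metric that is not Kaehler is, after
    rescaling, governed by a closed 1-form theta of norm 1, up to sign its Lee
    form: if theta + i eta has type (1,0), then the fundamental form is
    theta /\ eta + d eta, and d eta is a transverse Kaehler form.  The invariant
    choice on this surface is theta = e^3, eta = e^4, with d eta = e^1 /\ e^2.
    Adding to theta the differential of a function f on the base torus keeps it
    closed and replaces d eta by (1 + Laplacian of f) e^1 /\ e^2, so the
    transverse geometry, which is that of a metric on the base torus, ceases to
    be flat.

    Take f to depend on x only and put a = f', h = 1 + a'.  Then
      theta = e^3 + a e^2,   eta = e^4 - a e^1,   d eta = h e^1 /\ e^2,
      g = theta^2 + eta^2 + h (dx^2 + dy^2),   omega = theta /\ eta + d eta,
    and d omega = - theta /\ d eta = - theta /\ omega, so the Lee form is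
    - theta.  It is parallel: g is locally the product of the line, with the
    coordinate w + f, and of a circle bundle over the torus with base metric
    h (dx^2 + dy^2) and curvature form the base area form.  The scalar curvature
    is therefore 2 K - 1/2, with K the Gauss curvature of the base; it is
    constant only if h is, and the profile a = sin(2 pi x) / (4 pi) gives
    values of different signs at x = 0 and x = 1/2.

    All tensors depend on x alone, through a, h and m = h' / (2 h), and
      a' = h - 1,   h' = 2 h m,   K = - m' / h,
    so the Levi-Civita connection (bundle_connection_levi_civita), the parallel
    Lee form (bundle_vaisman) and the Ricci tensor (ricci_bundle) reduce to
    polynomial identities in a, h, m and m', checked component by component. *)

(** * Smooth functions of one variable *)

(** Iterating the derivative on whole functions, rather than asking for
    derivatives of all orders at a point, makes smoothness stable under sums and
    products by induction on the order. *)
Fixpoint differentiable_times (R : realType) (n : nat) (f : R -> R) : Prop :=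
  if n is m.+1
  then (forall x, derivable f x 1) /\ differentiable_times m (derive1 f)
  else True.

Definition smooth_line (R : realType) (f : R -> R) : Prop :=
  forall n, differentiable_times n f.

Lemma differentiable_timesW (R : realType) (n : nat) (f : R -> R) :
  differentiable_times n.+1 f -> differentiable_times n f.
Proof. by elim: n f => [//|n IH] f [df /IH ddf]; split. Qed.

Lemma smooth_line_derivable (R : realType) (f : R -> R) (x : R) :
  smooth_line f -> derivable f x 1.
Proof. by move=> /(_ 1%N) [df _]. Qed.

Lemma smooth_line_derive1 (R : realType) (f : R -> R) :
  smooth_line f -> smooth_line (derive1 f).
Proof. by move=> sf n; have [] := sf n.+1. Qed.

Lemma smooth_line_is_derive (R : realType) (f : R -> R) (x : R) :
  smooth_line f -> is_derive x 1 f (derive1 f x).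
Proof.
by move=> sf; rewrite derive1E; apply/derivableP/smooth_line_derivable.
Qed.

Lemma is_derive_derive1 (R : realType) (f df : R -> R) :
  (forall x : R, is_derive x 1 f (df x)) -> derive1 f = df.
Proof. by move=> H; apply/funext => x; rewrite derive1E derive_val. Qed.

Lemma differentiable_times_cst (R : realType) (n : nat) (c : R) :
  differentiable_times n (fun _ : R => c).
Proof.
elim: n c => [//|n IH] c; split=> [x|]; first exact: derivable_cst.
by rewrite (is_derive_derive1 (df := fun=> 0)).
Qed.

Lemma differentiable_timesD (R : realType) (n : nat) (f g : R -> R) :
  differentiable_times n f -> differentiable_times n g ->
  differentiable_times n (fun x => f x + g x).
Proof.
elim: n f g => [//|n IH] f g [df ddf] [dg ddg].
have D (x : R) : is_derive x 1 (fun x => f x + g x) (derive1 f x + derive1 g x).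
  by rewrite !derive1E; apply: is_deriveD; exact/derivableP.
by split=> [x|]; [case: (D x)|rewrite (is_derive_derive1 D); exact: IH].
Qed.

Lemma differentiable_timesM (R : realType) (n : nat) (f g : R -> R) :
  differentiable_times n f -> differentiable_times n g ->
  differentiable_times n (fun x => f x * g x).
Proof.
elim: n f g => [//|n IH] f g Hf Hg.
have [[df ddf] [dg ddg]] := (Hf, Hg).
have D (x : R) : is_derive x 1 (fun x => f x * g x)
    (f x * derive1 g x + g x * derive1 f x).
  by rewrite !derive1E; apply: is_deriveM; exact/derivableP.
split=> [x|]; first by case: (D x).
rewrite (is_derive_derive1 D).
by apply: differentiable_timesD; apply: IH => //; exact: differentiable_timesW.
Qed.

Lemma smooth_line_cst (R : realType) (c : R) : smooth_line (fun=> c).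
Proof. by move=> n; exact: differentiable_times_cst. Qed.

Lemma smooth_lineD (R : realType) (f g : R -> R) :
  smooth_line f -> smooth_line g -> smooth_line (fun x => f x + g x).
Proof. by move=> sf sg n; exact: differentiable_timesD. Qed.

Lemma smooth_lineM (R : realType) (f g : R -> R) :
  smooth_line f -> smooth_line g -> smooth_line (fun x => f x * g x).
Proof. by move=> sf sg n; exact: differentiable_timesM. Qed.

Lemma smooth_lineN (R : realType) (f : R -> R) :
  smooth_line f -> smooth_line (fun x => - f x).
Proof.
move=> sf; rewrite [X in smooth_line X](_ : _ = fun x => -1 * f x).
  exact/smooth_lineM/sf/smooth_line_cst.
by apply/funext => x; rewrite mulN1r.
Qed.

Lemma is_derive_scale (R : realType) (c x : R) :
  is_derive x 1 (fun x => c * x) c.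
Proof.
rewrite -[X in is_derive _ _ _ X]mulr1.
exact: (is_deriveZ c (is_derive_id x 1)).
Qed.

Lemma is_derive_sin_scale (R : realType) (c x : R) :
  is_derive x 1 (fun x => sin (c * x)) (c * cos (c * x)).
Proof.
have D := is_derive_scale c x.
by have := is_derive1_comp (is_derive_sin (c * x)) D; rewrite mulrC.
Qed.

Lemma is_derive_cos_scale (R : realType) (c x : R) :
  is_derive x 1 (fun x => cos (c * x)) (- c * sin (c * x)).
Proof.
have D := is_derive_scale c x.
have := is_derive1_comp (is_derive_cos (c * x)) D.
by rewrite mulNr [sin _ * _]mulrC mulNr.
Qed.

(** Sine and cosine have to be treated together, each being up to a constant the
    derivative of the other. *)
Lemma smooth_line_sin (R : realType) (c : R) :
  smooth_line (fun x => sin (c * x)).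
Proof.
suff H n : differentiable_times n (fun x => sin (c * x)) /\
    differentiable_times n (fun x => cos (c * x)) by move=> n; have [] := H n.
elim: n => [//|n [IHs IHc]]; split; split.
- by move=> x; case: (is_derive_sin_scale c x).
- rewrite (is_derive_derive1 (is_derive_sin_scale c)).
  exact/differentiable_timesM/IHc/differentiable_times_cst.
- by move=> x; case: (is_derive_cos_scale c x).
- rewrite (is_derive_derive1 (is_derive_cos_scale c)).
  exact/differentiable_timesM/IHs/differentiable_times_cst.
Qed.

Lemma derive1_shift (R : realType) (f : R -> R) (t : R) :
  (forall x, f (x + t) = f x) -> forall x, derive1 f (x + t) = derive1 f x.
Proof.
move=> ft x; rewrite /derive1.
by under eq_fun do rewrite addrA !ft.
Qed.

(** * Functions of x alone *)

(** The difference quotients of F(x) along v are those of F along the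
    x-component of v, before any limit is taken; so a directional derivative is
    transported to the line even where F is not differentiable. *)
Lemma diff_quotient_crd0 (R : realType) (F : R -> R) (v p : R4 R) :
  (fun h : R =>
     h^-1 *: (((fun q => F (crd 0 q)) \o shift p) (h *: v) - F (crd 0 p)))
  = (fun h : R =>
     h^-1 *: ((F \o shift (crd 0 p)) (h *: crd 0 v) - F (crd 0 p))).
Proof. by apply/funext => h; rewrite /= /crd !mxE. Qed.

Lemma derivable_crd0 (R : realType) (F : R -> R) (v p : R4 R) :
  derivable F (crd 0 p) (crd 0 v) -> derivable (fun q => F (crd 0 q)) p v.
Proof. by rewrite /derivable diff_quotient_crd0. Qed.

Lemma derive_crd0 (R : realType) (F : R -> R) (v p : R4 R) :
  'D_v (fun q => F (crd 0 q)) p = 'D_(crd 0 v) F (crd 0 p).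
Proof. by rewrite /derive diff_quotient_crd0. Qed.

Lemma crd0_delta (R : realType) (i : 'I_4) :
  crd 0 (delta_mx 0 i : R4 R) = (i == 0 :> nat)%:R.
Proof. by rewrite /crd mxE eqxx -val_eqE /= inordK // eq_sym. Qed.

Lemma partial_crd0 (R : realType) (i : 'I_4) (F : R -> R) :
  partial i (fun p => F (crd 0 p))
  = fun p => (if i == 0 :> nat then derive1 F else cst 0) (crd 0 p).
Proof.
apply/funext => p; rewrite /partial derive_crd0 crd0_delta.
by case: eqP => _; rewrite ?derive0 ?derive1E.
Qed.

Lemma smooth_crd0 (R : realType) (F : R -> R) :
  smooth_line F -> smooth (fun p : R4 R => F (crd 0 p)).
Proof.
move=> sF s.
have [G [-> sG]] : exists G : R -> R,
    partials s (fun p => F (crd 0 p)) = (fun p => G (crd 0 p)) /\ smooth_line G.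
  elim: s => [|i s [G [E sG]]]; first by exists F.
  exists (if i == 0 :> nat then derive1 G else cst 0); split.
    by rewrite /= E (partial_crd0 i G).
  by case: ifP => _; [exact: smooth_line_derive1|exact: smooth_line_cst].
split=> [p|i p].
- apply: (@continuous_comp _ _ _ (@crd R 0) G); first exact: coord_continuous.
  by apply/differentiable_continuous/derivable1_diffP/smooth_line_derivable.
- apply: derivable_crd0; rewrite crd0_delta.
  by case: eqP => _; [exact: smooth_line_derivable|exact: derivable0].
Qed.

Lemma crd0_lattice_act (R : realType) (j k m n : int) (p : R4 R) :
  crd 0 (lattice_act j k m n p) = crd 0 p + j%:~R.
Proof. by rewrite /lattice_act {1}/crd mxE inordK. Qed.

Lemma smooth_on_M_crd0 (R : realType) (F : R -> R) :
  smooth_line F -> (forall (j : int) (x : R), F (x + j%:~R) = F x) ->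
  smooth_on_M (fun p : R4 R => F (crd 0 p)).
Proof.
move=> sF pF; split; first exact: smooth_crd0.
by move=> j k m n p; rewrite crd0_lattice_act.
Qed.

(** Only e_2 = d/dx, of index 1, has an x-component. *)
Lemma fd_crd0 (R : realType) (a : 'I_4) (F : R -> R) (p : R4 R) :
  fd a (fun q => F (crd 0 q)) p
  = if a == 1 :> nat then derive1 F (crd 0 p) else 0.
Proof.
rewrite /fd derive_crd0; have -> : crd 0 (frame a p) = (a == 1 :> nat)%:R.
  by case: a => [[|[|[|[|//]]]] ?]; rewrite /frame /= /crd mxE inordK.
by case: eqP => _; rewrite ?derive0 ?derive1E.
Qed.

(** * The metrics *)

(** The density h of the area form d eta = h e^1 /\ e^2 on the base. *)
Definition area (R : realType) (a : R -> R) (x : R) : R := 1 + derive1 a x.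

(** The data a = f': any smooth function of period 1 with h > 0. *)
Definition profile (R : realType) (a : R -> R) : Prop :=
  [/\ smooth_line a,
      forall (j : int) (x : R), a (x + j%:~R) = a x
    & forall x : R, 0 < area a x].

(** The coefficient m = h' / (2 h) is half the logarithmic derivative of h; the
    Christoffel symbols of h (dx^2 + dy^2) are m, - m and 0. *)
Definition half_dlog (R : realType) (a : R -> R) (x : R) : R :=
  derive1 (area a) x / (2 * area a x).

(** The components of theta^2 + eta^2 + h (dx^2 + dy^2) in the frame
    e_1, ..., e_4. *)
Definition metric_mx (R : realType) (a h : R) : 'M[R]_4 :=
  \matrix_(b < 4) mkrow (nth [::]
    [:: [:: h + a * a; 0; 0; - a];
        [:: 0; h + a * a; a; 0];
        [:: 0; a; 1; 0];
        [:: - a; 0; 0; 1]] b).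

Definition inverse_metric_mx (R : realType) (a h : R) : 'M[R]_4 :=
  \matrix_(b < 4) mkrow (nth [::]
    [:: [:: h^-1; 0; 0; a / h];
        [:: 0; h^-1; - a / h; 0];
        [:: 0; - a / h; 1 + a * a / h; 0];
        [:: a / h; 0; 0; 1 + a * a / h]] b).

(** The x-derivative of metric_mx, by a' = h - 1 and h' = 2 h m. *)
Definition dmetric_mx (R : realType) (a h m : R) : 'M[R]_4 :=
  \matrix_(b < 4) mkrow (nth [::]
    [:: [:: 2 * h * m + 2 * a * (h - 1); 0; 0; 1 - h];
        [:: 0; 2 * h * m + 2 * a * (h - 1); h - 1; 0];
        [:: 0; h - 1; 0; 0];
        [:: 1 - h; 0; 0; 0]] b).

Definition bundle_metric (R : realType) (a : R -> R) (p : R4 R) : 'M[R]_4 :=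
  metric_mx (a (crd 0 p)) (area a (crd 0 p)).

(** omega = (h + a^2) e^12 + a e^13 + a e^24 + e^34 *)
Definition fundamental_mx (R : realType) (a h : R) : 'M[R]_4 :=
  \matrix_(b < 4) mkrow (nth [::]
    [:: [:: 0; h + a * a; a; 0];
        [:: - (h + a * a); 0; 0; a];
        [:: - a; 0; 0; 1];
        [:: 0; - a; -1; 0]] b).

Definition dfundamental_mx (R : realType) (a h m : R) : 'M[R]_4 :=
  \matrix_(b < 4) mkrow (nth [::]
    [:: [:: 0; 2 * h * m + 2 * a * (h - 1); h - 1; 0];
        [:: - (2 * h * m + 2 * a * (h - 1)); 0; 0; h - 1];
        [:: 1 - h; 0; 0; 0];
        [:: 0; 1 - h; 0; 0]] b).

(** The form - theta = - e^3 - a e^2. *)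
Definition bundle_lee (R : realType) (a : R -> R) (p : R4 R) : 'rV[R]_4 :=
  mkrow [:: 0; - a (crd 0 p); -1; 0].

(** The components of nabla_(e_b) e_c.  They come from the orthogonal frame
      u_1 = e_1 + a e_4,   u_2 = e_2 - a e_3,   u_3 = e_3,   u_4 = e_4,
    of square norms h, h, 1, 1, whose only bracket is [u_1, u_2] = - h u_4:
      nabla_1 u_1 = - m u_2,             nabla_1 u_2 = m u_1 - (h / 2) u_4,
      nabla_2 u_1 = m u_1 + (h / 2) u_4, nabla_2 u_2 = m u_2,
      nabla_1 u_4 = nabla_4 u_1 = u_2 / 2,
      nabla_2 u_4 = nabla_4 u_2 = - u_1 / 2,
    and the other derivatives vanish.  An empty row stands for the zero
    vector. *)
Definition christoffel (R : realType) (a h m : R) (b c : nat) : seq R :=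
  nth [::] (nth [::]
    [:: [:: [:: 0; - (m + a); a * (m + a); 0];
            [:: m + a / 2; 0; 0; a * (m + a / 2) - h / 2];
            [::];
            [:: 0; 2^-1; - (a / 2); 0]];
        [:: [:: m + a / 2; 0; 0; a * (m + a / 2) + 1 - h / 2];
            [:: 0; m; h - 1 - a * m; 0];
            [::];
            [:: - 2^-1; 0; 0; - (a / 2)]];
        [::];
        [:: [:: 0; 2^-1; - (a / 2); 0];
            [:: - 2^-1; 0; 0; - (a / 2)];
            [::];
            [::]]] b) c.

(** The x-derivative of christoffel, with n = m'. *)
Definition dchristoffel (R : realType) (a h m n : R) (b c : nat) : seq R :=
  nth [::] (nth [::]
    [:: [:: [:: 0; - (n + (h - 1)); (h - 1) * (m + a) + a * (n + (h - 1)); 0];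
            [:: n + (h - 1) / 2; 0; 0;
                (h - 1) * (m + a / 2) + a * (n + (h - 1) / 2) - h * m];
            [::];
            [:: 0; 0; - ((h - 1) / 2); 0]];
        [:: [:: n + (h - 1) / 2; 0; 0;
                (h - 1) * (m + a / 2) + a * (n + (h - 1) / 2) - h * m];
            [:: 0; n; 2 * h * m - (h - 1) * m - a * n; 0];
            [::];
            [:: 0; 0; 0; - ((h - 1) / 2)]];
        [::];
        [:: [:: 0; 0; - ((h - 1) / 2); 0];
            [:: 0; 0; 0; - ((h - 1) / 2)];
            [::];
            [::]]] b) c.

Definition bundle_connection (R : realType) (a : R -> R) : connection R :=
  fun b c p =>
    let x := crd 0 p in
    mkrow (christoffel (a x) (area a x) (half_dlog a x) b c).

(** In the frame u_1, ..., u_4 the Ricci tensor is diagonal, with entries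
    - n - h / 2 = h (K - 1/2) twice, then 0 and 1/2. *)
Definition ricci_mx (R : realType) (a h n : R) : 'M[R]_4 :=
  \matrix_(b < 4) mkrow (nth [::]
    [:: [:: - n - h / 2 + a * a / 2; 0; 0; - (a / 2)];
        [:: 0; - n - h / 2; 0; 0];
        [::];
        [:: - (a / 2); 0; 0; 2^-1]] b).

Notation ord4 k := (@Ordinal 4 k isT).

Lemma sum4 (R : realType) (F : 'I_4 -> R) :
  \sum_(i < 4) F i = F (ord4 0) + F (ord4 1) + F (ord4 2) + F (ord4 3).
Proof.
rewrite !big_ord_recl big_ord0 addr0 !addrA.
by congr (F _ + F _ + F _ + F _); exact: val_inj.
Qed.

Ltac case4 i := case: i => [[|[|[|[|//]]]] ?].

Lemma mkrowE (R : realType) (s : seq R) (d : 'I_4) : mkrow s 0 d = s`_d.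
Proof. exact: mxE. Qed.

Lemma mkrowsE (R : realType) (rows : seq (seq R)) (b c : 'I_4) :
  (\matrix_(i < 4) mkrow (nth [::] rows i)) b c = (nth [::] rows b)`_c.
Proof. by rewrite !mxE. Qed.

Lemma bracketE (R : realType) (b c k : 'I_4) :
  bracket R b c 0 k =
    if (b == 0 :> nat) && (c == 1 :> nat) then [:: 0; 0; 0; -1]`_k
    else if (b == 1 :> nat) && (c == 0 :> nat) then [:: 0; 0; 0; 1]`_k else 0.
Proof. by rewrite /bracket; do 2?[case: ifP => _]; rewrite !mxE. Qed.

(** Turns every component of a table into an iterated nth, which computes once
    the indices are concrete. *)
Definition tableE := (mkrowE, mkrowsE, bracketE).

(** * Pointwise algebra of the metric *)

Lemma metric_mxV (R : realType) (b h : R) :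
  h != 0 -> metric_mx b h *m inverse_metric_mx b h = 1%:M.
Proof.
move=> h0; apply/matrixP => i j.
rewrite [LHS]mxE [RHS]mxE sum4 !tableE -val_eqE.
by case4 i; case4 j; rewrite /=; field.
Qed.

Lemma invmx_metric (R : realType) (b h : R) :
  h != 0 -> invmx (metric_mx b h) = inverse_metric_mx b h.
Proof.
move=> h0; have E := metric_mxV b h0; have [u _] := mulmx1_unit E.
by rewrite -[RHS]mul1mx -(mulVmx u) -mulmxA E mulmx1.
Qed.

Lemma bil_metric_mx (R : realType) (b h : R) (X : 'rV[R]_4) :
  bil (metric_mx b h) X X =
    h * (X 0 (ord4 0) ^+ 2 + X 0 (ord4 1) ^+ 2)
    + (X 0 (ord4 2) + b * X 0 (ord4 1)) ^+ 2
    + (X 0 (ord4 3) - b * X 0 (ord4 0)) ^+ 2.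
Proof. by rewrite /bil !mxE !sum4 !mxE !sum4 !mxE /=; ring. Qed.

Lemma Jmx_metric (R : realType) (b h : R) :
  Jmx R *m metric_mx b h *m (Jmx R)^T = metric_mx b h.
Proof.
rewrite Jmx_tr mulmxN; apply/matrixP => i j.
by rewrite !mxE !sum4 !mxE !sum4 !mxE;
  case4 i; case4 j; rewrite /= ?mxE /=; ring.
Qed.

Lemma metric_mx_tr (R : realType) (b h : R) : (metric_mx b h)^T = metric_mx b h.
Proof.
by apply/matrixP => i j; case4 i; case4 j; rewrite !mxE /= ?mxE.
Qed.

(** bil_metric_mx is a sum of squares whose linear forms are independent. *)
Lemma metric_mx_gt0 (R : realType) (b h : R) (X : 'rV[R]_4) :
  0 < h -> X != 0 -> 0 < bil (metric_mx b h) X X.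
Proof.
move=> h0 X0; rewrite bil_metric_mx.
set X2 := X 0 (ord4 2) + _; set X3 := X 0 (ord4 3) - _.
have n01 : 0 <= h * (X 0 (ord4 0) ^+ 2 + X 0 (ord4 1) ^+ 2).
  by rewrite mulr_ge0 ?addr_ge0 ?sqr_ge0 // ltW.
rewrite lt_neqAle eq_sym !addr_ge0 ?sqr_ge0 // andbT.
apply: contraNN X0; rewrite !paddr_eq0 ?addr_ge0 ?sqr_ge0 //.
rewrite mulf_eq0 gt_eqF //= paddr_eq0 ?sqr_ge0 // !sqrf_eq0.
move=> /andP[/andP[/andP[/eqP E0 /eqP E1] /eqP E2] /eqP E3].
move: E2 E3; rewrite /X2 /X3 E0 E1 !mulr0 addr0 subr0 => E2 E3.
by apply/eqP/rowP => i; rewrite mxE; case4 i; [rewrite -[RHS]E0|rewrite -[RHS]E1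
  |rewrite -[RHS]E2|rewrite -[RHS]E3]; congr (X _ _); exact: val_inj.
Qed.

(** * Derivatives of the components *)

Lemma area_gt0 (R : realType) (a : R -> R) (pa : profile a)
    (x : R) : 0 < area a x.
Proof. by have [_ _] := pa; apply. Qed.

Lemma area_neq0 (R : realType) (a : R -> R) (pa : profile a)
    (x : R) : area a x != 0.
Proof. by rewrite gt_eqF ?(area_gt0 pa). Qed.

Lemma smooth_line_area (R : realType) (a : R -> R) (pa : profile a) :
  smooth_line (area a).
Proof.
have [sa _ _] := pa.
exact: smooth_lineD (smooth_line_cst 1) (smooth_line_derive1 sa).
Qed.

Lemma fd_is_derive (R : realType) (F : R -> R) (dF : R) (e : 'I_4) (p : R4 R) :
  is_derive (crd 0 p) 1 F dF ->
  fd e (fun q => F (crd 0 q)) p = (e == 1 :> nat)%:R * dF.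
Proof.
move=> DF; rewrite (fd_crd0 e F) derive1E derive_val.
by case: eqP; rewrite ?mul1r ?mul0r.
Qed.

(** The rules of calculus for functions written as abstractions, the form in
    which is_derive_tac below recognizes the entries of the tables. *)
Lemma is_derive_addf (R : realType) (f g : R -> R) (x df dg : R) :
  is_derive x 1 f df -> is_derive x 1 g dg ->
  is_derive x 1 (fun y => f y + g y) (df + dg).
Proof. exact: is_deriveD. Qed.

Lemma is_derive_oppf (R : realType) (f : R -> R) (x df : R) :
  is_derive x 1 f df -> is_derive x 1 (fun y => - f y) (- df).
Proof. exact: is_deriveN. Qed.

Lemma is_derive_mulf (R : realType) (f g : R -> R) (x df dg : R) :
  is_derive x 1 f df -> is_derive x 1 g dg ->
  is_derive x 1 (fun y => f y * g y) (f x * dg + g x * df).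
Proof. exact: is_deriveM. Qed.

Lemma is_derive_cstf (R : realType) (c x : R) : is_derive x 1 (fun=> c) 0.
Proof. exact: is_derive_cst. Qed.

(** Lets the rules compute a derivative before it is compared with df. *)
Lemma is_derive_exists (R : realType) (f : R -> R) (x df : R) :
  (exists2 d, is_derive x 1 f d & d = df) -> is_derive x 1 f df.
Proof. by case=> d Df <-. Qed.

Lemma is_derive_profile (R : realType) (a : R -> R) (pa : profile a)
    (x : R) : is_derive x 1 a (area a x - 1).
Proof.
have [sa _ _] := pa; rewrite /area addrC addKr.
exact: smooth_line_is_derive.
Qed.

Lemma is_derive_area (R : realType) (a : R -> R) (pa : profile a)
    (x : R) : is_derive x 1 (area a) (2 * area a x * half_dlog a x).
Proof.
have -> : 2 * area a x * half_dlog a x = derive1 (area a) x.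
  by rewrite /half_dlog; field; exact: area_neq0 pa _.
exact/smooth_line_is_derive/(smooth_line_area pa).
Qed.

Lemma is_derive_half_dlog (R : realType) (a : R -> R) (pa : profile a)
    (x : R) : is_derive x 1 (half_dlog a) (derive1 (half_dlog a) x).
Proof.
have sh := smooth_line_area pa.
rewrite derive1E; apply: derivableP; apply: derivableM.
  exact/smooth_line_derivable/smooth_line_derive1.
apply: derivableV; first by rewrite mulf_neq0 ?(area_neq0 pa) ?pnatr_eq0.
by apply: derivableM; [exact: derivable_cst|exact: smooth_line_derivable].
Qed.

(* Instance search is kept off the premises: it would try to differentiate the
   subterms by unfolding them. *)
Ltac is_derive_tac :=
  lazymatch goal with
  | |- is_derive _ _ (fun y => @?f y + @?g y) _ =>
      notypeclasses refine (@is_derive_addf _ f g _ _ _ _ _); is_derive_tac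
  | |- is_derive _ _ (fun y => @?f y * @?g y) _ =>
      notypeclasses refine (@is_derive_mulf _ f g _ _ _ _ _); is_derive_tac
  | |- is_derive _ _ (fun y => - @?f y) _ =>
      notypeclasses refine (@is_derive_oppf _ f _ _ _); is_derive_tac
  | |- is_derive _ _ (fun=> ?c) _ => exact: is_derive_cstf
  | |- is_derive _ _ (fun y => area _ y) _ => exact: is_derive_area
  | |- is_derive _ _ (fun y => half_dlog _ y) _ => exact: is_derive_half_dlog
  | |- _ => exact: is_derive_profile
  end.

Lemma is_derive_metric (R : realType) (a : R -> R) (pa : profile a)
    (b c : 'I_4) (x : R) :
  is_derive x 1 (fun y => metric_mx (a y) (area a y) b c)
    (dmetric_mx (a x) (area a x) (half_dlog a x) b c).
Proof.
by case4 b; case4 c; rewrite !mxE /=; under eq_fun do (rewrite ?mxE /=);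
  (apply: is_derive_exists; eexists; [is_derive_tac|rewrite /=; ring]).
Qed.

Lemma is_derive_christoffel (R : realType) (a : R -> R) (pa : profile a)
    (b c d : 'I_4) (x : R) :
  is_derive x 1
    (fun y => (christoffel (a y) (area a y) (half_dlog a y) b c)`_d)
    (dchristoffel (a x) (area a x) (half_dlog a x) (derive1 (half_dlog a) x)
       b c)`_d.
Proof.
by case4 b; case4 c; case4 d; rewrite /=;
  (apply: is_derive_exists; eexists; [is_derive_tac|rewrite /=; field]).
Qed.

(** * Hermitian metric and Levi-Civita connection *)

Lemma area_periodic (R : realType) (a : R -> R) (pa : profile a)
    (j : int) (x : R) : area a (x + j%:~R) = area a x.
Proof.
have [_ pera _] := pa.
by rewrite /area (derive1_shift (t := j%:~R)) // => y; exact: pera.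
Qed.

Lemma smooth_line_metric (R : realType) (a : R -> R) (pa : profile a)
    (b c : 'I_4) :
  smooth_line (fun y => metric_mx (a y) (area a y) b c).
Proof.
have [sa _ _] := pa; have sh := smooth_line_area pa.
have saa := smooth_lineM sa sa.
by case4 b; case4 c; under eq_fun do rewrite !mxE /=;
  rewrite /=; first [exact: smooth_line_cst | exact: smooth_lineD
    | exact: smooth_lineN | exact: sa].
Qed.

Lemma bundle_metric_hermitian (R : realType) (a : R -> R) (pa : profile a) :
  hermitian_metric (bundle_metric a).
Proof.
have [_ pera _] := pa.
split=> [b c|p X Y|p X X0|p X Y].
- apply: (smooth_on_M_crd0 (smooth_line_metric pa b c)) => j x.
  by rewrite pera (area_periodic pa).
- have -> : bil (bundle_metric a p) X Y = (Y *m bundle_metric a p *m X^T)^T 0 0.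
    by rewrite !trmx_mul trmxK metric_mx_tr mulmxA.
  by rewrite mxE.
- exact: metric_mx_gt0 (area_gt0 pa _) X0.
- by rewrite /bil trmx_mul !mulmxA -(mulmxA X) -(mulmxA X) Jmx_metric.
Qed.

Lemma fd_metric (R : realType) (a : R -> R) (pa : profile a)
    (e b c : 'I_4) (p : R4 R) (x := crd 0 p) :
  fd e (fun q => bundle_metric a q b c) p
  = (e == 1 :> nat)%:R * dmetric_mx (a x) (area a x) (half_dlog a x) b c.
Proof. exact: (fd_is_derive _ (is_derive_metric pa b c _)). Qed.

Lemma bundle_connection_levi_civita (R : realType) (a : R -> R)
    (pa : profile a) :
  is_levi_civita (bundle_metric a) (bundle_connection a).
Proof.
have [_ gsym _ _] := bundle_metric_hermitian pa.
split=> [b c p|e b c p].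
- apply/rowP => d.
  by case4 b; case4 c; case4 d; rewrite /bracket /= !mxE /=; field.
rewrite (fd_metric pa) (gsym _ (delta_mx 0 b)) !bil_deltar !mxE !sum4.
rewrite /bundle_connection /bundle_metric.
(* Only an identity between polynomials in the values of a, h, m remains. *)
move: (a _) (area a _) (half_dlog a _) => {p} a' h m.
rewrite !tableE.
by case4 e; case4 b; case4 c; rewrite /=; field.
Qed.

Lemma levi_civita_bundle (R : realType) (a : R -> R) (pa : profile a) :
  levi_civita (bundle_metric a) = bundle_connection a.
Proof.
have /(levi_civitaP _ (bundle_metric_hermitian pa)) E :=
  bundle_connection_levi_civita pa.
by apply/funext => b; apply/funext => c; apply/funext => p; rewrite E.
Qed.

(** * Lee form and parallelism *)

Lemma is_derive_fundamental (R : realType) (a : R -> R) (pa : profile a)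
    (b c : 'I_4) (x : R) :
  is_derive x 1 (fun y => fundamental_mx (a y) (area a y) b c)
    (dfundamental_mx (a x) (area a x) (half_dlog a x) b c).
Proof.
by case4 b; case4 c; rewrite tableE /=; under eq_fun do rewrite ?tableE /=;
  (apply: is_derive_exists; eexists; [is_derive_tac|rewrite /=; ring]).
Qed.

Lemma fundamental_bundle (R : realType) (a : R -> R) (p : R4 R) (x := crd 0 p) :
  fundamental_form (bundle_metric a) p = fundamental_mx (a x) (area a x).
Proof.
apply/matrixP => b c; rewrite /fundamental_form mxE sum4 !tableE.
by case4 b; case4 c; rewrite /=; ring.
Qed.

Lemma fd_fundamental (R : realType) (a : R -> R) (pa : profile a)
    (e b c : 'I_4) (p : R4 R) (x := crd 0 p) :
  fd e (fun q => fundamental_form (bundle_metric a) q b c) p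
  = (e == 1 :> nat)%:R * dfundamental_mx (a x) (area a x) (half_dlog a x) b c.
Proof.
under eq_fun do rewrite fundamental_bundle.
exact: (fd_is_derive _ (is_derive_fundamental pa b c _)).
Qed.

Lemma fd_lee (R : realType) (a : R -> R) (pa : profile a)
    (e b : 'I_4) (p : R4 R) :
  fd e (fun q => bundle_lee a q 0 b) p
  = - ((e == 1 :> nat)%:R * (b == 1 :> nat)%:R * (area a (crd 0 p) - 1)).
Proof.
rewrite -mulrA -mulrN.
apply: (@fd_is_derive _ (fun y => mkrow [:: 0; - a y; -1; 0] 0 b)).
case4 b; under eq_fun do rewrite mxE /=; rewrite /= ?mul1r ?mul0r ?oppr0;
  by [exact: is_derive_cstf
     | apply: is_derive_oppf; exact: is_derive_profile pa _].
Qed.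

Lemma bundle_lee_form (R : realType) (a : R -> R) (pa : profile a) :
  lee_form (bundle_metric a) (bundle_lee a).
Proof.
have [sa pera _] := pa.
split=> [b|e b c p].
  apply: (smooth_on_M_crd0 (F := fun y => mkrow [:: 0; - a y; -1; 0] 0 b)).
    by case4 b; under eq_fun do rewrite mxE /=;
      first [exact: smooth_line_cst | exact: smooth_lineN].
  by move=> j x; rewrite pera.
rewrite /d2 /wedge12 /bundle_lee !(fd_fundamental pa) !fundamental_bundle.
move: (half_dlog a _) (area a _) (a _) => m h a'.
rewrite !sum4 !tableE.
by case4 e; case4 b; case4 c; rewrite /=; ring.
Qed.

Lemma bundle_vaisman (R : realType) (a : R -> R) (pa : profile a) :
  vaisman (bundle_metric a).
Proof.
exists (bundle_lee a); split; first exact: bundle_lee_form pa.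
- move=> b c p; rewrite /d1 !(fd_lee pa) !sum4.
  by case4 b; case4 c; rewrite !tableE /=; ring.
- move=> b c p; rewrite (levi_civita_bundle pa) /nabla_form (fd_lee pa) sum4.
  rewrite /bundle_connection !tableE.
  by case4 b; case4 c; rewrite /=; field.
Qed.

(** * Curvature *)

Lemma curvature_component (R : realType) (C : connection R)
    (e b c d : 'I_4) (p : R4 R) :
  curvature C e b c p 0 d
  = nabla C e (C b c) p 0 d - nabla C b (C e c) p 0 d
    - \sum_(k < 4) bracket R e b 0 k * C k c p 0 d.
Proof.
have subE (u v : 'rV[R]_4) : (u - v) 0 d = u 0 d - v 0 d by rewrite !mxE.
rewrite /curvature !subE summxE; congr (_ - _).
by apply: eq_bigr => k _; rewrite mxE.
Qed.

Lemma fd_connection (R : realType) (a : R -> R) (pa : profile a)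
    (e b c d : 'I_4) (p : R4 R) (x := crd 0 p) :
  fd e (fun q => bundle_connection a b c q 0 d) p
  = (e == 1 :> nat)%:R
    * (dchristoffel (a x) (area a x) (half_dlog a x) (derive1 (half_dlog a) x)
         b c)`_d.
Proof.
under eq_fun do rewrite mkrowE.
exact: (fd_is_derive _ (is_derive_christoffel pa b c d _)).
Qed.

Lemma nabla_connection (R : realType) (a : R -> R) (pa : profile a)
    (e b c d : 'I_4) (p : R4 R) (x := crd 0 p)
    (G := christoffel (a x) (area a x) (half_dlog a x)) :
  nabla (bundle_connection a) e (bundle_connection a b c) p 0 d
  = (e == 1 :> nat)%:R
      * (dchristoffel (a x) (area a x) (half_dlog a x) (derive1 (half_dlog a) x)
           b c)`_d
    + \sum_(k < 4) (G b c)`_k * (G e k)`_d.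
Proof.
rewrite /nabla mxE mxE (fd_connection pa) summxE; congr (_ + _).
by apply: eq_bigr => k _; rewrite mxE !mkrowE.
Qed.

Lemma ricci_bundle (R : realType) (a : R -> R) (pa : profile a)
    (b c : 'I_4) (p : R4 R) (x := crd 0 p) :
  ricci (bundle_connection a) b c p
  = ricci_mx (a x) (area a x) (derive1 (half_dlog a) x) b c.
Proof.
rewrite /ricci.
under eq_bigr => e _.
  rewrite curvature_component !(nabla_connection pa).
  under [X in _ - X]eq_bigr => k _ do rewrite bracketE mkrowE.
  over.
rewrite /x mkrowsE.
move: (derive1 _ _) (half_dlog a _) (area a _) (a _) => n m h a'.
rewrite !sum4.
by case4 b; case4 c; rewrite /=; field.
Qed.

(** This is 2 K - 1/2, since K = - m' / h. *)
Lemma scalar_curvature_bundle (R : realType) (a : R -> R) (pa : profile a)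
    (p : R4 R) (x := crd 0 p) :
  scalar_curvature (bundle_metric a) p
  = - 2 * derive1 (half_dlog a) x / area a x - 2^-1.
Proof.
have h0 := area_neq0 pa x.
rewrite /scalar_curvature (levi_civita_bundle pa) invmx_metric //.
under eq_bigr => b _ do under eq_bigr => c _ do rewrite (ricci_bundle pa).
rewrite sum4 !sum4 !mxE /=.
by field.
Qed.

(** * Non-constant scalar curvature *)

(** Differentiating h' = 2 h m at a zero of h', where m = 0 as well, leaves
    h'' = 2 h m'. *)
Lemma scalar_curvature_critical (R : realType) (a : R -> R) (pa : profile a)
    (p : R4 R) (x := crd 0 p) :
  derive1 (area a) x = 0 ->
  scalar_curvature (bundle_metric a) p
  = - (derive1 (derive1 (area a)) x / area a x ^+ 2) - 2^-1.
Proof.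
move=> dh0; have h0 := area_neq0 pa x.
have m0 : half_dlog a x = 0 by rewrite /half_dlog dh0 mul0r.
have -> : derive1 (area a) = fun y => 2 * area a y * half_dlog a y.
  exact: is_derive_derive1 (is_derive_area pa).
have /is_derive_derive1 -> : forall y : R, is_derive y 1
    (fun y => 2 * area a y * half_dlog a y)
    (2 * area a y * derive1 (half_dlog a) y
     + half_dlog a y * (2 * (2 * area a y * half_dlog a y) + area a y * 0)).
  move=> y; apply: is_derive_mulf; last exact: is_derive_half_dlog.
  by apply: is_derive_mulf;
    first [exact: is_derive_cstf | exact: is_derive_area].
rewrite (scalar_curvature_bundle pa) -/x m0.
by field.
Qed.

Definition sine_profile (R : realType) (x : R) : R :=
  (4 * pi)^-1 * sin (2 * pi * x).

Lemma sin_periodic_int (R : realType) (j : int) (x : R) :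
  sin (2 * pi * (x + j%:~R)) = sin (2 * pi * x).
Proof.
have H (n : nat) (y : R) : sin (2 * pi * (y + n%:R)) = sin (2 * pi * y).
  rewrite -[RHS](periodicn (@sinD2pi R) n); congr sin.
  by ring.
case: j => n; first exact: H.
by rewrite -[LHS](H n.+1) NegzE mulrNz subrK.
Qed.

Lemma area_sine_profile (R : realType) :
  area (@sine_profile R) = fun x => 1 + 2^-1 * cos (2 * pi * x).
Proof.
have pi0 : pi != 0 :> R by rewrite gt_eqF ?pi_gt0.
have D (x : R) : is_derive x 1 (@sine_profile R)
    ((4 * pi)^-1 * (2 * pi * cos (2 * pi * x)) + sin (2 * pi * x) * 0).
  by apply: is_derive_mulf;
    first [exact: is_derive_cstf | exact: is_derive_sin_scale].
apply/funext => x; rewrite /area (is_derive_derive1 D).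
by move: (pi : R) pi0 => c c0; field.
Qed.

Lemma sine_profileP (R : realType) : profile (@sine_profile R).
Proof.
split=> [|j x|x].
- exact: smooth_lineM (smooth_line_cst _) (smooth_line_sin _).
- by rewrite /sine_profile sin_periodic_int.
- rewrite area_sine_profile.
  by have := cos_geN1 (2 * pi * x); lra.
Qed.

Lemma derive1_area_sine_profile (R : realType) :
  derive1 (area (@sine_profile R)) = fun x => - pi * sin (2 * pi * x).
Proof.
have D (x : R) : is_derive x 1 (fun x => 1 + 2^-1 * cos (2 * pi * x))
    (0 + (2^-1 * (- (2 * pi) * sin (2 * pi * x)) + cos (2 * pi * x) * 0)).
  by apply: is_derive_addf; apply: is_derive_mulf;
    first [exact: is_derive_cstf | exact: is_derive_cos_scale].
rewrite area_sine_profile (is_derive_derive1 D).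
by apply/funext => x; field.
Qed.

Lemma derive2_area_sine_profile (R : realType) :
  derive1 (derive1 (area (@sine_profile R)))
  = fun x => - (2 * pi ^+ 2) * cos (2 * pi * x).
Proof.
have D (x : R) : is_derive x 1 (fun x => - pi * sin (2 * pi * x))
    (- pi * (2 * pi * cos (2 * pi * x)) + sin (2 * pi * x) * 0).
  by apply: is_derive_mulf;
    first [exact: is_derive_cstf | exact: is_derive_sin_scale].
rewrite derive1_area_sine_profile (is_derive_derive1 D).
by apply/funext => x; ring.
Qed.

Theorem mainTheorem3 (R : realType) :
  exists g : R4 R -> 'M[R]_4,
    [/\ hermitian_metric g,
        T2_invariant (fundamental_form g),
        vaisman g
      & exists p q : R4 R, scalar_curvature g p <> scalar_curvature g q].
Proof.
have P := sine_profileP R.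
exists (bundle_metric (@sine_profile R)); split.
- exact: bundle_metric_hermitian.
- by move=> p q pq _; rewrite !fundamental_bundle pq.
- exact: bundle_vaisman.
exists (mkrow [:: 0; 0; 0; 0]), (mkrow [:: 2^-1; 0; 0; 0]).
have x0 : crd 0 (mkrow [:: 0; 0; 0; 0] : R4 R) = 0.
  by rewrite /crd mkrowE inordK.
have x1 : crd 0 (mkrow [:: 2^-1; 0; 0; 0] : R4 R) = 2^-1.
  by rewrite /crd mkrowE inordK.
have E : 2 * pi * 2^-1 = pi :> R by field.
rewrite !(scalar_curvature_critical P) ?x0 ?x1; first last.
- by rewrite derive1_area_sine_profile mulr0 sin0 mulr0.
- by rewrite derive1_area_sine_profile E sinpi mulr0.
rewrite derive2_area_sine_profile area_sine_profile E mulr0 cos0 cospi.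
(* The two values are 8 pi^2 / 9 - 1/2 and - 8 pi^2 - 1/2. *)
have pi2 : 0 < pi ^+ 2 :> R by rewrite exprn_gt0 ?pi_gt0.
move: (pi ^+ 2) pi2 => s s0 /eqP.
rewrite -subr_eq0 (_ : _ - _ = s * (80 / 9)); last by field.
by rewrite mulf_eq0 !gt_eqF.
Qed.
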